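(* Let $(W,S)$ be a finite irreducible Coxeter system, let $\mathcal{P}$ be a parameter tensor for $(W,S)$, and let $v\in\mathcal{R}(w_\circ)$ be a reduced word of the longest element $w_\circ$, with abelian vector $\alpha_v$. The determinant of the model matrix $M(v,\mathcal{P})$ of $v$ with respect to $\mathcal{P}$ is the multivariate polynomial \[ \det M(v,\mathcal{P})=\sigma(v)\;\mathcal{V}(v)\sum_{\mathfrak{z}\in\mathfrak{Z}_{\alpha_v}}\det[\mathcal{P}]_{\mathfrak{z}}\;\mathsf{S}_{\Lambda_{\mathfrak{z}},\Omega_v}, \] where $\Lambda_{\mathfrak{z}}=(\lambda^{\mathfrak{z},1},\dots,\lambda^{\mathfrak{z},n})$ is the sequence of standard partitions of $\mathfrak{z}$, $\Omega_v=(\{v\}_1,\dots,\{v\}_n)$, and $\mathsf{S}_{\Lambda_{\mathfrak{z}},\Omega_v}$ is the partial Schur function with respect to $\Lambda_{\mathfrak{z}}$ and $\Omega_v$.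
   Context: Setting. $(W,S)$ is a finite irreducible Coxeter system with $S=\{s_1<\dots<s_n\}$, $w_\circ$ is its longest element, $N$ is the length of $w_\circ$, $\mathcal{R}(w_\circ)$ is the set of reduced words of $w_\circ$ (words of length $N$ in $S$ representing $w_\circ$), and $\nu$ is the maximum number of occurrences of a letter in any word of $\mathcal{R}(w_\circ)$. Words. For $v=v_1\cdots v_N$, let $\{v\}_i:=\{j\in[N]:v_j=s_i\}$ and $c_i:=\#\{v\}_i$; the abelian vector is $\alpha_v=(c_1,\dots,c_n)$. The $S$-sign is $\sigma(v)=(-1)^{\operatorname{inv}(v)}$, where $\operatorname{inv}(v)$ is the number of pairs $a<b$ with $v_b<v_a$. The Vandermonde divisor of $v$ is \[\mathcal{V}(v):=\prod_{s_i\in S,\ c_i\ge 2}\ \prod_{v_j=v_k=s_i,\ j<k}(x_k-x_j).\] Parameter tensor and model matrix. A parameter tensor for $(W,S)$ is a real array $\mathcal{P}=(p^i{}_{s,k})$ with $(i,s,k)\in[N]\times S\times\{0,\dots,\nu-1\}$, regarded as an $N\times n\nu$ matrix with rows indexed by $i$ and columns indexed by pairs $(s,k)$ in lexicographic order. The model matrix $M(v,\mathcal{P})$ is the $N\times N$ matrix over $\mathbb{R}[x_1,\dots,x_N]$ whose $(i,l)$ entry is $\sum_{k=0}^{\nu-1}p^i{}_{v_l,k}\,x_l^{k}$. Minors. $\mathfrak{Z}_{\alpha_v}$ is the collection of subsets $\mathfrak{z}\subseteq S\times\{0,\dots,\nu-1\}$ containing exactly $c_i$ elements with first coordinate $s_i$,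 for every $i\in[n]$. $[\mathcal{P}]_{\mathfrak{z}}$ is the $N\times N$ submatrix of $\mathcal{P}$ with columns $\mathfrak{z}$ in increasing lexicographic order. For $\mathfrak{z}\in\mathfrak{Z}_{\alpha_v}$ and $i\in[n]$, the standard partition $\lambda^{\mathfrak{z},i}$ is obtained by listing the second coordinates of the elements of $\mathfrak{z}$ with first coordinate $s_i$ in decreasing order and subtracting $c_i-j$ from the entry at position $j$, $j=1,\dots,c_i$. Schur functions. For a partition $\lambda=(\lambda_1\ge\dots\ge\lambda_d\ge0)$ and an ordered index set $J$ with $\#J=d$, \[\mathsf{s}_{\lambda,J}:=\frac{\det\big(x_j^{\,i-1+\lambda_{d-i+1}}\big)_{(i,j)\in[d]\times J}}{\det\big(x_j^{\,i-1}\big)_{(i,j)\in[d]\times J}}.\] For an ordered set partition $P=(p_1,\dots,p_n)$ of $[N]$ (empty parts allowed) and a sequence $\Lambda=(\lambda^1,\dots,\lambda^n)$ of partitions where $\lambda^i$ has $\#p_i$ parts (parts may be zero), the partial Schur function is $\mathsf{S}_{\Lambda,P}:=\prod_{i=1}^n\mathsf{s}_{\lambda^i,p_i}$. *)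

(* Defs.v *)
From HB Require Import structures.
From mathcomp Require Import all_boot all_order all_algebra all_fingroup.
From mathcomp Require Import reals.
From mathcomp Require Import fraction mpoly.

Set Implicit Arguments.
Unset Strict Implicit.
Unset Printing Implicit Defensive.

Import GRing.Theory.
Local Open Scope ring_scope.

Definition word_val (gT : finGroupType) (n : nat) (s : 'I_n -> gT)
  (w : seq 'I_n) : gT := (\prod_(i <- w) s i)%g.

(* (W, S) with W finite and S = {s_0 < ... < s_(n-1)}: W is the group presented
   by the generators s_i and the relations (s_i s_j)^(m i j) = 1, for a Coxeter
   matrix m.  An entry m i j = 0 encodes the absence of a relation
   (m i j = oo); the universal property ranges over arbitrary groups,
   finite or not. *)
Structure finCoxeterSystem := FinCoxeterSystem {
  cox_group :> finGroupType;
  cox_rank : nat;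
  cox_gen : 'I_cox_rank -> cox_group;
  cox_mat : 'I_cox_rank -> 'I_cox_rank -> nat;
  cox_mat_sym : forall i j, cox_mat i j = cox_mat j i;
  cox_mat_eq1 : forall i j, (cox_mat i j == 1)%N = (i == j);
  cox_generated : <<[set cox_gen i | i : 'I_cox_rank]>>%g = [set: cox_group];
  cox_relations : forall i j,
    ((cox_gen i * cox_gen j) ^+ cox_mat i j = 1)%g;
  cox_universal : forall (H : groupType) (t : 'I_cox_rank -> H),
    (forall i j, ((t i * t j) ^+ cox_mat i j = 1)%g) ->
    exists f : {multiplicative cox_group -> H}, forall i, f (cox_gen i) = t i
}.

(* Coxeter graph: i and j are adjacent iff m i j >= 3 or m i j = oo. *)
Definition cox_edge (C : finCoxeterSystem) : rel 'I_(cox_rank C) :=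
  fun i j => (i != j) && (cox_mat i j != 2)%N.

Definition cox_irreducible (C : finCoxeterSystem) : Prop :=
  forall i j : 'I_(cox_rank C), connect (@cox_edge C) i j.

Lemma word_val_surj (C : finCoxeterSystem) (w : C) :
  exists k, [exists t : k.-tuple 'I_(cox_rank C), word_val (@cox_gen C) t == w].
Proof.
have: w \in <<[set @cox_gen C i | i : 'I_(cox_rank C)]>>%g.
  by rewrite cox_generated inE.
case/gen_prodgP=> k [c cP ->].
have /fin_all_exists[f fP] : forall i : 'I_k, exists j, c i = @cox_gen C j.
  by move=> i; have /imsetP[j _ ->] := cP i; exists j.
exists k; apply/existsP; exists [tuple f i | i < k].
rewrite /word_val big_tuple.
by apply/eqP/eq_bigr => i _; rewrite tnth_mktuple fP.
Qed.

Definition cox_length (C : finCoxeterSystem) (w : C) : nat :=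
  ex_minn (word_val_surj w).

(* The element of maximal length (unique, as W is finite). *)
Definition longest (C : finCoxeterSystem) : C :=
  [arg max_(w > (1%g : C)) cox_length w].

Definition coxN (C : finCoxeterSystem) : nat := cox_length (longest C).

Definition longest_words (C : finCoxeterSystem) :
    {set (coxN C).-tuple 'I_(cox_rank C)} :=
  [set v : (coxN C).-tuple _ | word_val (@cox_gen C) v == longest C].

Definition cox_nu (C : finCoxeterSystem) : nat :=
  (\max_(v : (coxN C).-tuple 'I_(cox_rank C) | v \in longest_words C)
     \max_(i < cox_rank C) count_mem i v)%N.

Definition parameter_tensor (R : realType) (C : finCoxeterSystem) : Type :=
  'I_(coxN C) -> 'I_(cox_rank C) -> 'I_(cox_nu C) -> R.

Section Words.
Variables (R : realType) (N n : nat) (v : N.-tuple 'I_n).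

Definition occurrences (i : 'I_n) : {set 'I_N} := [set j | tnth v j == i].

Definition abelian_vector (i : 'I_n) : nat := #|occurrences i|.

Definition inv_number : nat :=
  #|[set ab : 'I_N * 'I_N | (ab.1 < ab.2)%N && (tnth v ab.2 < tnth v ab.1)%N]|.

Definition S_sign : {mpoly R[N]} := (-1) ^+ inv_number.

Definition vandermonde_divisor : {mpoly R[N]} :=
  \prod_(i < n | (2 <= abelian_vector i)%N)
    \prod_(j in occurrences i) \prod_(k in occurrences i | (j < k)%N)
      ('X_k - 'X_j).

End Words.

Section Tensors.
Variables (R : realType) (N n nu : nat) (P : 'I_N -> 'I_n -> 'I_nu -> R).

Definition model_matrix (v : N.-tuple 'I_n) : 'M[{mpoly R[N]}]_N :=
  \matrix_(i, l) \sum_(k < nu) (P i (tnth v l) k)%:MP * 'X_l ^+ k.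

(* [enum z] lists z in increasing lexicographic order (enum_lex below).  When
   #|z| = N, which holds for z in column_sets (abelian_vector v), the default
   value of the indexing is never used. *)
Definition column_minor (z : {set 'I_n * 'I_nu}) : 'M[R]_N :=
  \matrix_(i, l) [seq P i sk.1 sk.2 | sk <- enum z]`_l.

End Tensors.

Definition lex (n nu : nat) : rel ('I_n * 'I_nu) :=
  fun x y => (x.1 < y.1)%N || (x.1 == y.1) && (x.2 < y.2)%N.

Lemma enum_lex (n nu : nat) (z : {set 'I_n * 'I_nu}) :
  sorted (@lex n nu) (enum z).
Proof.
have tr : transitive (@lex n nu).
  move=> y x w /orP[xy|/andP[/eqP xy1 xy2]] /orP[yw|/andP[/eqP yw1 yw2]].
  - by rewrite /lex (ltn_trans xy yw).
  - by rewrite /lex -yw1 xy.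
  - by rewrite /lex xy1 yw.
  by rewrite /lex xy1 yw1 eqxx (ltn_trans xy2 yw2) orbT.
rewrite /enum_mem; apply: (sorted_filter tr).
have pw k : pairwise (fun a b : 'I_k => (a < b)%N) (enum 'I_k).
  rewrite -(@pairwise_map _ _ val ltn) val_enum_ord.
  by rewrite -(sorted_pairwise ltn_trans) iota_ltn_sorted.
rewrite (sorted_pairwise tr) unlock /= /prod_enum.
elim: (enum 'I_n) (pw n) => //= a r IH /andP[/allP ar /IH pr].
rewrite pairwise_cat pr andbT pairwise_map; apply/andP; split.
  apply/allrelP => _ _ /mapP[b _ ->] /allpairsP[[c d] /= [cr _ ->]].
  by rewrite /lex /= ar.
by apply: sub_pairwise (pw nu) => b c /= bc; rewrite /lex /= eqxx bc orbT.
Qed.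

Definition column_sets (n nu : nat) (c : 'I_n -> nat) :
    {set {set 'I_n * 'I_nu}} :=
  [set z : {set 'I_n * 'I_nu} | [forall i, #|[set x in z | x.1 == i]| == c i]].

(* In 0-based positions, the entry at position j is decreased by d - (j + 1).
   The list ks is strictly decreasing, so the subtraction never truncates. *)
Definition standard_partition (n nu : nat) (z : {set 'I_n * 'I_nu})
    (i : 'I_n) : seq nat :=
  let ks := rev [seq val k | k <- enum [set k | (i, k) \in z]] in
  let d := size ks in
  mkseq (fun j => (nth 0%N ks j - (d - j.+1))%N) d.

Section Schur.
Variables (R : realType) (N : nat).

(* Row i below is row i + 1 of the usual 1-based formula, and la_(d-i+1) is at
   0-based position d - (i + 1).  [enum_val] lists J increasingly. *)
Definition schur_numer (la : seq nat) (J : {set 'I_N}) :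
    'M[{mpoly R[N]}]_#|J| :=
  \matrix_(i, j) 'X_(enum_val j) ^+ (i + nth 0%N la (#|J| - i.+1)).

Definition schur_denom (J : {set 'I_N}) : 'M[{mpoly R[N]}]_#|J| :=
  \matrix_(i, j) 'X_(enum_val j) ^+ i.

Definition schur (la : seq nat) (J : {set 'I_N}) : {fraction {mpoly R[N]}} :=
  tofrac (\det (schur_numer la J)) / tofrac (\det (schur_denom J)).

Definition partial_schur (n : nat) (La : 'I_n -> seq nat)
    (p : 'I_n -> {set 'I_N}) : {fraction {mpoly R[N]}} :=
  \prod_(i < n) schur (La i) (p i).

End Schur.

(* Main.v *)
(** The model matrix factors as M(v, P) = P X, where the row of X indexed by
    (s, k) has the entry x_l^k in each column l with v_l = s and 0 elsewhere.
    By the Cauchy-Binet formula, det M is the sum over z of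
    det [P]_z det [X]^z.  Stably sorting the columns of [X]^z by letter costs
    the sign (-1)^inv(v) and makes [X]^z block diagonal when z lies in
    Z_(alpha_v) (its determinant vanishes otherwise); the i-th block is the
    numerator of the i-th Schur function, and the product of the denominators
    is the Vandermonde divisor. *)

Require Import Defs.
From HB Require Import structures.
From mathcomp Require Import all_boot all_order all_algebra all_fingroup.
From mathcomp Require Import reals.
From mathcomp Require Import fraction mpoly.

Set Implicit Arguments.
Unset Strict Implicit.
Unset Printing Implicit Defensive.

Import GRing.Theory.
Local Open Scope ring_scope.

(** * The Cauchy-Binet formula over a finite index type *)

(** Multilinearity expands the determinant over all maps [f] from columns to [T]. Repeated columns
    kill the non-injective ones; an injective [f] with image [z] is the enumeration of [z] composed
    with a permutation. *)
Lemma Cauchy_Binet (R : comNzRingType) (N : nat) (T : finType)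
    (A : 'I_N -> T -> R) (B : T -> 'I_N -> R) :
  \det (\matrix_(i, j) \sum_t A i t * B t j) =
    \sum_(z : {set T} | #|z| == N)
      \det (\matrix_(i < N, l < N) [seq A i t | t <- enum z]`_l) *
      \det (\matrix_(l < N, j < N) [seq B t j | t <- enum z]`_l).
Proof.
(* The permutation acts on rows, so that the product runs over columns and distributes over the
   choices [f j]. *)
have detE (M : 'M[R]_N) :
    \det M = \sum_(s : 'S_N) (-1) ^+ s * \prod_j M (s j) j.
  rewrite -det_tr; apply: eq_bigr => s _; congr (_ * _).
  by apply: eq_bigr => j _; rewrite mxE.
have -> : \det (\matrix_(i, j) \sum_t A i t * B t j) =
    \sum_(f : {ffun 'I_N -> T})
      \det (\matrix_(i, j) A i (f j)) * \prod_j B (f j) j.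
  rewrite detE; under eq_bigr => s _.
    under eq_bigr => j _ do rewrite mxE.
    rewrite bigA_distr_bigA big_distrr /=; over.
  rewrite exchange_big /=; apply: eq_bigr => f _.
  rewrite detE mulr_suml; apply: eq_bigr => s _.
  rewrite big_split /= mulrA; congr (_ * _ * _).
  by apply: eq_bigr => j _; rewrite mxE.
rewrite (bigID (fun f : {ffun 'I_N -> T} => injectiveb f)) /=.
rewrite [X in _ + X]big1 ?addr0; last first.
  move=> f /injectivePn[i [j neq_ij fij]].
  rewrite -det_tr (determinant_alternate neq_ij) ?mul0r // => k.
  by rewrite !mxE fij.
rewrite (partition_big (fun f : {ffun 'I_N -> T} => [set f x | x in 'I_N])
  (fun z => #|z| == N)) /=; last first.
  by move=> f /injectiveP f_inj; rewrite card_imset // card_ord.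
apply: eq_bigr => z /eqP zN.
pose h (i : 'I_N) : T := enum_val (cast_ord (esym zN) i).
have h_inj : injective h by move=> i j /enum_val_inj/cast_ord_inj.
have nth_h (F : T -> R) (l : 'I_N) : [seq F t | t <- enum z]`_l = F (h l).
  by rewrite (nth_map (h l)) -?cardE ?zN // [in RHS]/h (enum_val_nth (h l)).
pose ph (s : 'S_N) := [ffun j => h (s j)] : {ffun 'I_N -> T}.
(* The default [1] is reached only by maps outside the sum to be reindexed. *)
pose ph' (f : {ffun 'I_N -> T}) : 'S_N := odflt 1%g [pick s | f == ph s].
have phK : cancel ph ph'.
  move=> s; rewrite /ph'; case: pickP => [u /eqP su | /(_ s)] /=.
    by apply/permP => j; move/ffunP/(_ j): su; rewrite !ffunE => /h_inj.
  by rewrite eqxx.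
rewrite (reindex_onto ph ph') /=; last first.
  move=> f /andP[/injectiveP f_inj /eqP fz].
  have /fin_all_exists[g gP] : forall j : 'I_N, exists k, f j = h k.
    move=> j; have fjz : f j \in z by rewrite -fz imset_f.
    exists (cast_ord zN (enum_rank_in fjz (f j))).
    by rewrite /h cast_ordK enum_rankK_in.
  have g_inj : injective g by move=> i j gij; apply: f_inj; rewrite !gP gij.
  rewrite /ph'; case: pickP => [s /eqP -> //|/(_ (perm g_inj)) /eqP[]].
  by apply/ffunP => j; rewrite ffunE permE gP.
rewrite [X in _ = _ * X]detE mulr_sumr; apply: eq_big => [s | s _].
  rewrite phK eqxx andbT; apply/andP; split.
    by apply/injectiveP => i j; rewrite !ffunE => /h_inj/perm_inj.
  rewrite eqEcard; apply/andP; split.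
    by apply/subsetP => _ /imsetP[j _ ->]; rewrite ffunE enum_valP.
  rewrite zN card_imset ?card_ord // => i j.
  by rewrite !ffunE => /h_inj/perm_inj.
(* Reordering the columns by [s] yields its sign, which completes the Leibniz sum of the second
   minor. *)
have -> : \matrix_(i, j) A i (ph s j) =
    (\matrix_(i, l) [seq A i t | t <- enum z]`_l) *m perm_mx s^-1.
  rewrite -col_permE; apply/matrixP => i j.
  by rewrite !mxE nth_h ffunE.
rewrite det_mulmx det_perm odd_permV -mulrA; congr (_ * (_ * _)).
by apply: eq_bigr => j _; rewrite mxE nth_h ffunE.
Qed.

(** * Determinants indexed by sequences of rows and columns *)

Section SequenceMinors.
Variables (R : comNzRingType) (T U : Type) (A : T -> U -> R).

(** Rows are stored as functions, so that zero serves as default and [T] and [U] need no default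
    element. The size [m] is independent of the lengths, which avoids casts on concatenations. *)
Definition seqmx m (rs : seq T) (cs : seq U) : 'M[R]_m :=
  \matrix_(i, j) [seq nth (fun=> 0) (map A rs) i c | c <- cs]`_j.

Lemma det_seqmx_swap m rs c1 x y c2 :
  size (c1 ++ x :: y :: c2) = m ->
  \det (seqmx m rs (c1 ++ x :: y :: c2)) =
    - \det (seqmx m rs (c1 ++ y :: x :: c2)).
Proof.
rewrite size_cat /= => szm.
have lt1 : (size c1 < m)%N by rewrite -szm -[ltnLHS]addn0 ltn_add2l.
have lt2 : ((size c1).+1 < m)%N by rewrite -szm -[ltnLHS]addn1 ltn_add2l.
pose j1 := Ordinal lt1; pose j2 := Ordinal lt2.
have -> : seqmx m rs (c1 ++ x :: y :: c2) =
    xcol j1 j2 (seqmx m rs (c1 ++ y :: x :: c2)).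
  apply/matrixP => i j; rewrite !mxE !map_cat !nth_cat !size_map /=.
  case: tpermP => [-> | -> | nj1 nj2] /=.
  - by rewrite ltnn subnn ltnNge leqnSn /= subSnn.
  - by rewrite ltnn subnn ltnNge leqnSn /= subSnn.
  case: ltnP => // le_j; case Dj: (j - size c1)%N => [|[|k]] //=.
    by case: nj1; apply/val_inj; rewrite /= -[LHS](subnKC le_j) Dj addn0.
  by case: nj2; apply/val_inj; rewrite /= -[LHS](subnKC le_j) Dj addn1.
rewrite xcolE det_mulmx det_perm odd_tperm.
have -> : j1 != j2 by rewrite -val_eqE /= neq_ltn ltnSn.
by rewrite mulrN1.
Qed.

(** [x] passes the entries of [c2] one at a time, each adjacent swap changing the sign. *)
Lemma det_seqmx_move m rs c1 x c2 c3 :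
  size (c1 ++ x :: c2 ++ c3) = m ->
  \det (seqmx m rs (c1 ++ x :: c2 ++ c3)) =
    (-1) ^+ size c2 * \det (seqmx m rs (c1 ++ c2 ++ x :: c3)).
Proof.
elim: c2 c1 => [|y c2 IH] c1 /= szm; first by rewrite mul1r.
rewrite det_seqmx_swap // -cat_rcons IH ?cat_rcons ?exprS ?mulN1r ?mulNr //.
by move: szm; rewrite !size_cat.
Qed.

(** The upper right block vanishes, so the matrix is block lower triangular. *)
Lemma det_seqmx_block m1 m2 r1 r2 c1 c2 :
    size r1 = m1 -> size c1 = m1 -> size r2 = m2 -> size c2 = m2 ->
    (forall i j, [seq nth (fun=> 0) (map A r1) i c | c <- c2]`_j = 0) ->
  \det (seqmx (m1 + m2) (r1 ++ r2) (c1 ++ c2)) =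
    \det (seqmx m1 r1 c1) * \det (seqmx m2 r2 c2).
Proof.
move=> sr1 sc1 sr2 sc2 A0.
rewrite -(det_lblock _ (\matrix_(i, j)
  [seq nth (fun=> 0) (map A r2) i c | c <- c1]`_j)); congr (\det _).
apply/matrixP => i j.
rewrite !mxE !map_cat !nth_cat !size_map sr1 sc1.
by case: (splitP i) => i' ->; rewrite !mxE; case: (splitP j) => j' ->;
  rewrite !mxE ?addKn ?A0.
Qed.

End SequenceMinors.

(** * Stable bucket sort and inversions *)

Section Buckets.
Variables (T : Type) (key : T -> nat).

Definition key_class i (s : seq T) := [seq x <- s | key x == i].

Fixpoint bucket_sort n s :=
  if n is m.+1 then bucket_sort m s ++ key_class m s else [::].

Fixpoint key_inversions s :=
  if s is x :: s' then
    (count (fun y => (key y < key x)%N) s' + key_inversions s')%N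
  else 0%N.

Lemma size_bucket_sort n s :
  size (bucket_sort n s) = count (fun x => (key x < n)%N) s.
Proof.
elim: n => [|n IH] /=; first by elim: s => //= x s <-.
rewrite size_cat IH size_filter.
elim: s {IH} => //= x s <-; rewrite ltnS [(key x <= n)%N]leq_eqVlt addnACA.
congr (_ + _)%N.
by case: eqP => [->|_]; rewrite ?ltnn ?addn0.
Qed.

(** By stability, the head [x] lands right after the entries of smaller key, so [size s1] counts the
    inversions that it starts. *)
Lemma bucket_sort_cons n x s : (key x < n)%N ->
  exists s1 s2, [/\ bucket_sort n s = s1 ++ s2,
    bucket_sort n (x :: s) = s1 ++ x :: s2 &
    size s1 = count (fun y => (key y < key x)%N) s].
Proof.
elim: n => // n IH; rewrite ltnS leq_eqVlt => /predU1P[kx | lt_xn].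
  exists (bucket_sort n s), (key_class n s); split=> //=.
    rewrite /key_class /= kx eqxx; congr (_ ++ _).
    (* Buckets of index below [key x] do not see [x]. *)
    have : (n <= key x)%N by rewrite kx.
    elim: n {kx IH} => //= n IH lt_nx; rewrite IH 1?ltnW // /key_class /=.
    by rewrite gtn_eqF.
  by rewrite size_bucket_sort kx.
have [s1 [s2 [e1 e2 sz]]] := IH lt_xn.
exists s1, (s2 ++ key_class n s); split=> //=; first by rewrite e1 catA.
by rewrite e2 /key_class /= ltn_eqF // -catA.
Qed.

Lemma bucket_sort_id n s : all (fun x => (key x < n)%N) s ->
  key_inversions s = 0%N -> bucket_sort n s = s.
Proof.
elim: s => [_ _|x s IH /= /andP[xn sn] /eqP]; first by elim: n => //= n ->.
rewrite addn_eq0 => /andP[/eqP cx /eqP inv_s].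
have [s1 [s2 [e1 -> sz]]] := bucket_sort_cons s xn.
by move: e1; rewrite IH // (size0nil (etrans sz cx)) => ->.
Qed.

End Buckets.

(** * Sorting columns and splitting into diagonal blocks *)

Section SortedMinors.
Variables (R : comNzRingType) (T U : Type) (A : T -> U -> R).
Variables (kT : T -> nat) (kU : U -> nat).

(** Behind a fixed prefix, the tail is sorted first; the head then moves past exactly the entries
    with which it forms inversions. *)
Lemma det_seqmx_bucket_sort n m rs cs : all (fun x => (kU x < n)%N) cs ->
  size cs = m ->
  \det (seqmx A m rs cs) =
    (-1) ^+ key_inversions kU cs * \det (seqmx A m rs (bucket_sort kU n cs)).
Proof.
move=> cs_n; suff gen pre : size (pre ++ cs) = m ->
    \det (seqmx A m rs (pre ++ cs)) = (-1) ^+ key_inversions kU cs *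
      \det (seqmx A m rs (pre ++ bucket_sort kU n cs)) by exact: (gen [::]).
elim: cs pre cs_n => [|x cs IH] pre /= cs_n szm.
  by rewrite mul1r; elim: n {cs_n} => //= n ->; rewrite cats0.
have /andP[xn {}cs_n] := cs_n.
have [s1 [s2 [e1 -> sz]]] := bucket_sort_cons cs xn.
have szb : size (bucket_sort kU n cs) = size cs.
  by rewrite size_bucket_sort; apply/eqP; rewrite -all_count.
rewrite -cat_rcons IH ?cat_rcons //.
rewrite e1 det_seqmx_move ?sz ?mulrA -?exprD 1?addnC //.
by rewrite -e1 -szm !size_cat /= szb.
Qed.

Hypothesis A0 : forall r c, kT r != kU c -> A r c = 0.

(** Induction on [n] splits off the last bucket: rows of key below [n] meet columns of key [n] only
    in zeros, by [A0]. *)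
Lemma det_seqmx_blocks n rs cs m (d : nat -> nat) :
    m = (\sum_(i < n) d i)%N ->
    (forall i, (i < n)%N -> size (key_class kT i rs) = d i) ->
    (forall i, (i < n)%N -> size (key_class kU i cs) = d i) ->
  \det (seqmx A m (bucket_sort kT n rs) (bucket_sort kU n cs)) =
    \prod_(i < n) \det (seqmx A (d i) (key_class kT i rs) (key_class kU i cs)).
Proof.
have szb V (k : V -> nat) s j : (forall i, (i < j)%N ->
    size (key_class k i s) = d i) ->
    size (bucket_sort k j s) = (\sum_(i < j) d i)%N.
  elim: j => [|j IH] dj; first by rewrite big_ord0.
  rewrite big_ord_recr /= size_cat dj // IH // => i ij.
  by apply: dj; apply: ltnW.
move=> -> {m}; elim: n => [|n IH] dr dc /=.
  by rewrite !big_ord0 det_mx00.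
have dr' i : (i < n)%N -> size (key_class kT i rs) = d i.
  by move=> lt_in; apply/dr/ltnW.
have dc' i : (i < n)%N -> size (key_class kU i cs) = d i.
  by move=> lt_in; apply/dc/ltnW.
rewrite !big_ord_recr /= det_seqmx_block ?IH ?szb ?dr ?dc // => i j.
have : all (fun r => (kT r < n)%N) (bucket_sort kT n rs).
  elim: n {IH dr dc dr' dc'} => //= n IH; rewrite all_cat; apply/andP; split.
    by apply: sub_all IH => x /ltnW.
  by rewrite all_filter; elim: rs {IH} => //= x s ->;
    case: eqP => //= ->; rewrite leqnn.
have : all (fun c => kU c == n) (key_class kU n cs) by apply: filter_all.
(* Indices past the end of either list are covered too, the default being zero. *)
elim: (bucket_sort kT n rs) i => [|r rs' IHr] [|i] /= call.
- by move=> _; elim: (key_class _ _ _) j {call} => [|c s IHs] [|j] //=.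
- by move=> _; elim: (key_class _ _ _) j {call} => [|c s IHs] [|j] //=.
- case/andP=> rn _; elim: (key_class _ _ _) j call {IHr} => [|c s IHs] [|j] //=.
    by case/andP=> /eqP cn _; rewrite A0 // cn ltn_eqF.
  by case/andP=> _ /IHs.
by case/andP=> _; apply: IHr.
Qed.

End SortedMinors.

(** * Inversion counts and orders on indices *)

(** For members of [s], [r a b] says that [a] precedes [b]. This gives [inv_number] for words, and
    zero for lexicographic enumerations. *)
Lemma key_inversions_sum (T : eqType) (key : T -> nat) (r : rel T) (s : seq T) :
    irreflexive r -> (forall x y, r x y -> ~~ r y x) -> pairwise r s ->
  key_inversions key s =
    (\sum_(a <- s) \sum_(b <- s) (r a b && (key b < key a)%N))%N.
Proof.
move=> r_irr r_asym; elim: s => [_|x s IH /= /andP[xs /IH ->]].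
  by rewrite big_nil.
rewrite !big_cons r_irr add0n; congr (_ + _)%N.
  elim: s xs {IH} => [|y s IHs] /=; first by rewrite big_nil.
  by case/andP=> rxy /IHs ->; rewrite big_cons rxy.
apply: eq_big_seq => y y_s; rewrite big_cons.
by have /r_asym/negPf -> := allP xs y y_s.
Qed.

Lemma pairwise_enum_ord n : pairwise (fun a b : 'I_n => (a < b)%N) (enum 'I_n).
Proof.
rewrite -(@pairwise_map _ _ val ltn) val_enum_ord.
by rewrite -(sorted_pairwise ltn_trans) iota_ltn_sorted.
Qed.

Lemma enum_set_ord_sorted n (J : {set 'I_n}) :
  sorted ltn [seq val j | j <- enum J].
Proof.
rewrite (sorted_pairwise ltn_trans) pairwise_map /enum_mem.
by apply: pairwise_filter; rewrite -enumT; apply: pairwise_enum_ord.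
Qed.

(** Translates the Vandermonde product over positions into one over elements of [J]. *)
Lemma ltn_enum_val n (J : {set 'I_n}) (i j : 'I_#|J|) :
  (enum_val i < enum_val j)%N = (i < j)%N.
Proof.
have homo : {homo (@enum_val _ (mem J)) : a b / (a < b)%N}.
  move=> a b ab; have x0 := enum_val a; rewrite !(enum_val_nth x0).
  rewrite -!(nth_map _ 0%N val) -?cardE //.
  apply: (sorted_ltn_nth ltn_trans _ (enum_set_ord_sorted J)) => //;
    by rewrite inE size_map -cardE.
case: (ltngtP i j) => [/homo // | /homo lt_ji | /val_inj ->].
  by rewrite ltnNge ltnW.
by rewrite ltnn.
Qed.

(** Makes the truncated subtraction in [standard_partition] exact. *)
Lemma nth_ltn_sorted (s : seq nat) i :
  sorted ltn s -> (i < size s)%N -> (i <= nth 0%N s i)%N.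
Proof.
move=> s_sorted; elim: i => // i IH lt_is.
apply: leq_ltn_trans (IH (ltnW lt_is)) _.
by apply: (sorted_ltn_nth ltn_trans) => //; rewrite inE ltnW.
Qed.

Lemma lex_trans n nu : transitive (@lex n nu).
Proof.
move=> y x w /orP[xy|/andP[/eqP xy1 xy2]] /orP[yw|/andP[/eqP yw1 yw2]].
- by rewrite /lex (ltn_trans xy yw).
- by rewrite /lex -yw1 xy.
- by rewrite /lex xy1 yw.
by rewrite /lex xy1 yw1 eqxx (ltn_trans xy2 yw2) orbT.
Qed.

Lemma lex_irr n nu : irreflexive (@lex n nu).
Proof. by move=> x; rewrite /lex !ltnn andbF. Qed.

Lemma key_inversions_enum_lex n nu (z : {set 'I_n * 'I_nu}) :
  key_inversions (fun t => val t.1) (enum z) = 0%N.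
Proof.
rewrite (key_inversions_sum _ (@lex_irr n nu)).
- rewrite big1 // => a _; rewrite big1 // => b _.
  apply/eqP; rewrite eqb0; apply/negP => /andP[/orP[ab|/andP[/eqP -> _]]].
    by rewrite ltnNge ltnW.
  by rewrite ltnn.
- move=> a b ab; apply/negP => ba.
  by have := lex_trans ab ba; rewrite lex_irr.
by rewrite -(sorted_pairwise (@lex_trans n nu)) enum_lex.
Qed.

(** * Standard partitions and letter classes of column sets *)

Section StandardPartitions.
Variables (n nu : nat) (z : {set 'I_n * 'I_nu}) (i : 'I_n).

(** Position [d - r.+1] of the decreasing list holds entry [r] of the increasing one, lowered by
    [r]. Hence the Schur numerator has the second coordinates of [z] as exponents. *)
Lemma nth_standard_partition r d :
    let ks := [seq val k | k <- enum [set k | (i, k) \in z]] in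
    size ks = d -> (r < d)%N ->
  (r + nth 0%N (standard_partition z i) (d - r.+1))%N = nth 0%N ks r.
Proof.
move=> ks <- lt_r; have lt_r' : (size ks - r.+1 < size ks)%N.
  by rewrite ltn_subLR // addSn ltnS leq_addl.
rewrite /standard_partition -/ks size_rev nth_mkseq // nth_rev //.
rewrite !subnSK // !subKn ?(ltnW lt_r) //.
by rewrite subnKC // nth_ltn_sorted // enum_set_ord_sorted.
Qed.

Lemma enum_fst_class :
  key_class (fun t => val t.1) i (enum z) = enum [set t in z | t.1 == i].
Proof.
rewrite /key_class /enum_mem -filter_predI.
by apply: eq_filter => t; rewrite !inE andbC.
Qed.

Lemma enum_fst_class_map :
  enum [set t in z | t.1 == i] =
    [seq (i, k) | k <- enum [set k | (i, k) \in z]].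
Proof.
apply: (irr_sorted_eq (@lex_trans n nu) (@lex_irr n nu)) => [|| [j k]].
- exact: enum_lex.
- have := enum_set_ord_sorted [set k | (i, k) \in z]; rewrite !sorted_map.
  by apply: sub_sorted => k l /= kl; rewrite /lex /= eqxx kl orbT.
rewrite mem_enum !inE /=; apply/andP/mapP => [[jk /eqP <-]|[l lz [-> ->]]].
  by exists k; rewrite // mem_enum inE.
by rewrite eqxx; move: lz; rewrite mem_enum inE.
Qed.

End StandardPartitions.

Lemma sum_abelian_vector (n N : nat) (v : N.-tuple 'I_n) :
  (\sum_(i < n) abelian_vector v i)%N = N.
Proof.
rewrite -[RHS]card_ord -[RHS]sum1_card [RHS](partition_big (tnth v) xpredT) //=.
apply: eq_bigr => i _; rewrite sum1dep_card.
by apply: eq_card => j; rewrite !inE.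
Qed.

Lemma card_column_set (n nu : nat) (c : 'I_n -> nat) (z : {set 'I_n * 'I_nu}) :
  z \in column_sets nu c -> #|z| = (\sum_(i < n) c i)%N.
Proof.
rewrite inE => /forallP zP; rewrite -sum1_card (partition_big fst xpredT) //=.
by apply: eq_bigr => i _; rewrite sum1dep_card; apply/eqP/zP.
Qed.

(** * Minors of the monomial matrix *)

Section MonomialMatrix.
Variables (R : comNzRingType) (N n nu : nat) (v : N.-tuple 'I_n).
Variable (X : 'I_N -> R).

Definition letter_monomial (t : 'I_n * 'I_nu) (l : 'I_N) : R :=
  if t.1 == tnth v l then X l ^+ t.2 else 0.

Definition monomial_minor (z : {set 'I_n * 'I_nu}) : 'M[R]_N :=
  \matrix_(i, j) [seq letter_monomial t j | t <- enum z]`_i.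

Lemma monomial_minor_seqmx z :
  monomial_minor z = seqmx letter_monomial N (enum z) (enum 'I_N).
Proof.
apply/matrixP => i j; rewrite !mxE (nth_map j) ?size_enum_ord // nth_ord_enum.
by elim: (enum z) (val i) => [|t s IH] [|k] //=.
Qed.

(** A nonzero Leibniz term gives a permutation [s] matching each row to a position carrying its
    letter, so [z] has the letter counts of [v]. *)
Lemma det_monomial_minor_eq0 (z : {set 'I_n * 'I_nu}) : #|z| = N ->
  z \notin column_sets nu (abelian_vector v) -> \det (monomial_minor z) = 0.
Proof.
move=> zN; apply: contraNeq => det_neq0.
have [s sP] : exists s : 'S_N, forall i, monomial_minor z i (s i) != 0.
  have : ~~ [forall s : 'S_N, [exists i, monomial_minor z i (s i) == 0]].
    apply: contra det_neq0 => /forallP s0; apply/eqP/big1 => s _.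
    by have /existsP[i /eqP si0] := s0 s; rewrite (bigD1 i) //= si0 mul0r mulr0.
  case/forallPn => s /existsPn sP; exists s => i; exact: sP.
rewrite inE; apply/forallP => i; apply/eqP.
pose h (j : 'I_N) := enum_val (cast_ord (esym zN) j).
have h_inj : injective h by move=> j k /enum_val_inj/cast_ord_inj.
have hE j : (h j).1 = tnth v (s j).
  have := sP j; rewrite mxE (nth_map (h j)) -?cardE ?zN //.
  have -> : nth (h j) (enum z) j = h j.
    by rewrite [in RHS]/h (enum_val_nth (h j)).
  by rewrite /letter_monomial; case: ((h j).1 =P _); rewrite ?eqxx.
rewrite /abelian_vector -(card_preimset _ (@perm_inj _ s)).
rewrite -(card_imset _ h_inj); apply: eq_card => t.
rewrite !inE; apply/andP/imsetP => [[tz /eqP <-] | [j]].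
  exists (cast_ord zN (enum_rank_in tz t)).
    by rewrite !inE -hE /h cast_ordK enum_rankK_in.
  by rewrite /h cast_ordK enum_rankK_in.
by rewrite !inE -hE => /eqP <- ->; rewrite eqxx enum_valP.
Qed.

Lemma key_class_occurrences (i : 'I_n) :
  key_class (fun l => val (tnth v l)) i (enum 'I_N) = enum (occurrences v i).
Proof.
rewrite /key_class [RHS]/enum_mem -enumT.
by apply: eq_filter => l; rewrite !inE.
Qed.

Lemma key_inversions_word :
  key_inversions (fun l => val (tnth v l)) (enum 'I_N) = inv_number v.
Proof.
rewrite (key_inversions_sum _ _ _ (pairwise_enum_ord N)); first last.
- by move=> a b; rewrite -leqNgt; apply: ltnW.
- by move=> a /=; apply: ltnn.
rewrite big_enum /=; under eq_bigr => a _ do rewrite big_enum /=.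
rewrite pair_big /= /inv_number -sum1_card [RHS]big_mkcond /=.
by apply: eq_bigr => ab _; rewrite inE; case: ifP.
Qed.

(** The sign comes from sorting the columns alone: the rows, listed lexicographically, are already
    grouped by letter. *)
Lemma det_monomial_minor (z : {set 'I_n * 'I_nu}) :
    z \in column_sets nu (abelian_vector v) ->
  \det (monomial_minor z) = (-1) ^+ inv_number v *
    \prod_(i < n) \det (\matrix_(r < #|occurrences v i|, j < #|occurrences v i|)
      X (enum_val j) ^+ (r + nth 0%N (standard_partition z i)
                               (#|occurrences v i| - r.+1))).
Proof.
move=> zv.
have key_lt (V : Type) (f : V -> 'I_n) s :
    all (fun x => (val (f x) < n)%N) s.
  by elim: s => //= x s ->; rewrite ltn_ord.
rewrite monomial_minor_seqmx (@det_seqmx_bucket_sort _ _ _ _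
  (fun l => val (tnth v l)) n) ?key_lt ?size_enum_ord //.
rewrite key_inversions_word; congr (_ * _).
have size_class (i : 'I_n) : size (key_class (fun t => val t.1) i (enum z)) =
    #|occurrences v i|.
  rewrite enum_fst_class -cardE.
  by move: zv; rewrite inE => /forallP/(_ i)/eqP.
(* The rows are rewritten as their own bucket sort, to fit the block lemma. *)
rewrite -[enum z in LHS](@bucket_sort_id _ (fun t => val t.1) n) ?key_lt //;
  last exact: key_inversions_enum_lex.
have key0 t l : val t.1 != val (tnth v l) -> letter_monomial t l = 0.
  by rewrite val_eqE /letter_monomial => /negPf ->.
(* Block sizes are given as lengths of key classes, since they must be defined on all of [nat]. *)
rewrite (@det_seqmx_blocks _ _ _ _ (fun t => val t.1)
  (fun l => val (tnth v l)) key0 n _ _ N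
  (fun i => size (key_class (fun l => val (tnth v l)) i (enum 'I_N)))) //.
- apply: eq_bigr => i _; rewrite key_class_occurrences.
  rewrite enum_fst_class enum_fst_class_map.
  set ks := enum [set k | (i, k) \in z].
  have size_ks : size [seq val k | k <- ks] = #|occurrences v i|.
    by rewrite -size_class enum_fst_class enum_fst_class_map !size_map.
  rewrite -cardE; congr (\det _); apply/matrixP => r j; rewrite !mxE.
  have lt_r : (r < size ks)%N by rewrite -(size_map val) size_ks.
  rewrite (nth_map (enum_val j)) -?cardE // -enum_val_nth -map_comp.
  rewrite (nth_standard_partition size_ks) // -/ks.
  (* By [lt_r] the list is nonempty; its head supplies the default for [nth_map]. *)
  case: ks lt_r {size_ks} => // k0 ks' lt_r; rewrite !(nth_map k0) //.
  rewrite /letter_monomial /=.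
  by have := enum_valP j; rewrite inE => /eqP ->; rewrite eqxx.
- rewrite -[LHS](sum_abelian_vector v); apply: eq_bigr => i _.
  by rewrite key_class_occurrences -cardE.
move=> i lt_in; rewrite (size_class (Ordinal lt_in)).
by rewrite (key_class_occurrences (Ordinal lt_in)) -cardE.
Qed.

End MonomialMatrix.

(** * Schur denominators and the Vandermonde divisor *)

Section VandermondeDivisor.
Variables (R : realType) (N : nat).

Lemma det_schur_denom (J : {set 'I_N}) :
  \det (schur_denom R J) =
    \prod_(j in J) \prod_(k in J | (j < k)%N) ('X_k - 'X_j).
Proof.
have -> : schur_denom R J = Vandermonde #|J| (\row_j 'X_(enum_val j)).
  by apply/matrixP => i j; rewrite !mxE.
rewrite det_Vandermonde [RHS]big_enum_val; apply: eq_bigr => i _.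
rewrite [RHS]big_mkcondr [RHS]big_enum_val [LHS]big_mkcond.
by apply: eq_bigr => j _; rewrite ltn_enum_val !mxE.
Qed.

Lemma det_schur_denom_neq0 (J : {set 'I_N}) : \det (schur_denom R J) != 0.
Proof.
rewrite det_schur_denom; apply/prodf_neq0 => j _; apply/prodf_neq0 => k.
(* The coefficient of ['X_k] in ['X_k - 'X_j] is 1. *)
case/andP=> _ lt_jk; apply/eqP => /(congr1 (mcoeff U_(k))) /eqP.
by rewrite mcoeffB !mcoeffX mcoeff0 eqxx eq_mnm1 -val_eqE ltn_eqF //
  subr0 oner_eq0.
Qed.

(** A letter occurring at most once has no pair [j < k], so its denominator is an empty product. *)
Lemma vandermonde_divisorE n (v : N.-tuple 'I_n) :
  vandermonde_divisor R v =
    \prod_(i < n) \det (schur_denom R (occurrences v i)).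
Proof.
rewrite /vandermonde_divisor big_mkcond; apply: eq_bigr => i _.
rewrite det_schur_denom; case: ifPn => // le1.
rewrite big1 // => j jv; rewrite big1 // => k /andP[kv lt_jk].
case/negP: le1; rewrite /abelian_vector (cardsD1 j) jv (cardsD1 k).
by rewrite in_setD1 kv andbT -val_eqE gtn_eqF.
Qed.

End VandermondeDivisor.

(** * Assembly of the determinant formula *)

Lemma tofrac_vandermonde_partial_schur (R : realType) (N n : nat)
    (v : N.-tuple 'I_n) (La : 'I_n -> seq nat) :
  tofrac (vandermonde_divisor R v) * partial_schur R La (occurrences v) =
    tofrac (\prod_(i < n) \det (schur_numer R (La i) (occurrences v i))).
Proof.
rewrite vandermonde_divisorE !rmorph_prod -big_split /=.
apply: eq_bigr => i _; rewrite /schur mulrCA divff ?mulr1 //.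
by rewrite tofrac_eq0 det_schur_denom_neq0.
Qed.

Lemma det_model_matrix (R : realType) (N n nu : nat)
    (P : 'I_N -> 'I_n -> 'I_nu -> R) (v : N.-tuple 'I_n) :
  tofrac (\det (model_matrix P v)) =
    tofrac (S_sign R v) * tofrac (vandermonde_divisor R v) *
    \sum_(z in column_sets nu (abelian_vector v))
      tofrac (\det (column_minor P z))%:MP *
      partial_schur R (standard_partition z) (occurrences v).
Proof.
pose A i (t : 'I_n * 'I_nu) : {mpoly R[N]} := (P i t.1 t.2)%:MP.
pose B : 'I_n * 'I_nu -> 'I_N -> {mpoly R[N]} :=
  letter_monomial v (fun l => 'X_l).
have -> : model_matrix P v = \matrix_(i, j) \sum_t A i t * B t j.
  apply/matrixP => i j; rewrite !mxE.
  rewrite -(pair_bigA _ (fun s k => A i (s, k) * B (s, k) j)) /=.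
  (* Only the letter at position [j] contributes to column [j]. *)
  rewrite (bigD1 (tnth v j)) //= [X in _ = _ + X]big1 ?addr0 => [|s /negPf sv].
    by apply: eq_bigr => k _; rewrite /B /letter_monomial /= eqxx.
  by rewrite big1 // => k _; rewrite /B /letter_monomial /= sv mulr0.
rewrite Cauchy_Binet mulr_sumr rmorph_sum /= [LHS]big_mkcond [RHS]big_mkcond.
(* Termwise over all [z]: members of [column_sets] have [N] elements, and every other set of size
   [N] has a vanishing monomial minor. *)
apply: eq_bigr => z _; case: ifPn => [/eqP zN | zN]; last first.
  case: ifPn => // /card_column_set; rewrite sum_abelian_vector => /eqP.
  by rewrite (negPf zN).
rewrite -/(monomial_minor v (fun l => 'X_l : {mpoly R[N]}) z).
case: ifPn => [zv | zv]; last by rewrite det_monomial_minor_eq0 ?mulr0 ?rmorph0.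
have -> : \det (\matrix_(i < N, l < N) [seq A i t | t <- enum z]`_l) =
    (\det (column_minor P z))%:MP.
  rewrite -det_map_mx; congr (\det _); apply/matrixP => i l; rewrite !mxE.
  by elim: (enum z) (val l) => [|t s IH] [|k] //=; rewrite ?mpolyC0.
(* The divisor is paired with the partial Schur function, so that the denominators cancel. *)
rewrite det_monomial_minor // [RHS]mulrACA.
rewrite tofrac_vandermonde_partial_schur -!rmorphM /= mulrCA mulrA.
congr (tofrac (_ * _)); by apply: eq_bigr.
Qed.

Theorem theorem2 (R : realType) (C : finCoxeterSystem) (hC : cox_irreducible C)
    (P : parameter_tensor R C) (v : (coxN C).-tuple 'I_(cox_rank C))
    (hv : v \in longest_words C) :
  tofrac (\det (model_matrix P v)) =
    tofrac (S_sign R v) * tofrac (vandermonde_divisor R v) *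
    \sum_(z in column_sets (cox_nu C) (abelian_vector v))
      tofrac (\det (column_minor P z))%:MP *
      partial_schur R (standard_partition z) (occurrences v).
Proof. exact: det_model_matrix. Qed.
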